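(* For $p\in(0,1)$ let $D_0$ be the geometric distribution on $\{0,1,2,\dots\}$ given by $D_0(y)=(1-p)p^y$, and let $\mathrm{Cap}(D_0)$ be the capacity, in bits per channel use, of the binary repeat channel with replication distribution $D_0$ (the geometric deletion channel with replication parameter $p$). Then $$\mathrm{Cap}(D_0)\le \frac{1}{2\log 2}+o(1)\quad\text{bits/channel use}$$ when $p\to 1$, where the $o(1)$ term tends to $0$ as $p\to1$, and $\frac{1}{2\log 2}\approx 0.7214$.
   Context: $\log$ is the natural logarithm. For a random variable $D$ supported on the non-negative integers, the repeat channel with replication distribution $D$ takes a bit string $x_1x_2\cdots x_n\in\{0,1\}^n$ and outputs the string obtained by replacing each $x_i$ by $D_i$ consecutive copies of $x_i$ (deleting $x_i$ if $D_i=0$), where $D_1,D_2,\dots$ are i.i.d. copies of $D$; the receiver sees only the concatenated output string. $\mathrm{Cap}(D)$ is its Shannon capacity per input bit, i.e. the supremum of rates of reliable communication, equal to $\lim_{n\to\infty}\frac1n\sup_{X^n}I(X^n;Y)$, where $X^n$ ranges over random $n$-bit inputs and $Y$ is the output string. *)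

(* Defs.v *)
From mathcomp Require Export all_boot all_order all_algebra.
From mathcomp Require Export all_classical all_reals all_analysis.
Export Order.TTheory GRing.Theory Num.Theory.
Export numFieldNormedType.Exports.

Set Implicit Arguments.
Unset Strict Implicit.
Unset Printing Implicit Defensive.

Local Open Scope classical_set_scope.
Local Open Scope ring_scope.

Definition repeat_output (n : nat) (x : n.-tuple bool) (d : n.-tuple nat) :
    seq bool :=
  flatten [seq nseq (tnth d i) (tnth x i) | i <- enum 'I_n].

(* A replication distribution is given by its probability mass function
   D : nat -> R.  The value below is P(Y \in B | X^n = x): the sum runs over all
   replication patterns (d_1, ..., d_n), a pattern having probability
   \prod_i D d_i since the D_i are i.i.d. *)
Definition repeat_law (R : realType) (D : nat -> R) (n : nat)
    (x : n.-tuple bool) (B : set (seq bool)) : \bar R :=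
  (\esum_(d in [set d : n.-tuple nat | B (repeat_output x d)])
     (\prod_(i < n) D (tnth d i))%:E)%E.

(* Error probability of the code with M messages, encoder enc and decoder dec,
   when the transmitted message is uniformly distributed.  (Requiring the maximal
   error probability over the messages to be small instead yields the same
   capacity, by discarding the worst half of the codewords.) *)
Definition error_prob (R : realType) (D : nat -> R) (n M : nat)
    (enc : 'I_M -> n.-tuple bool) (dec : seq bool -> 'I_M) : \bar R :=
  ((M%:R^-1)%:E *
     \sum_(m < M) repeat_law D (enc m) [set y : seq bool | dec y != m])%E.

(* Rates are in bits per input bit: at rate r there are at least 2 ^ (n r)
   messages for n input bits. *)
Definition achievable (R : realType) (D : nat -> R) (r : R) : Prop :=
  forall e : R, 0 < e -> \forall n \near \oo,
    exists (M : nat) (enc : 'I_M -> n.-tuple bool) (dec : seq bool -> 'I_M),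
      2 `^ (n%:R * r) <= M%:R /\ (error_prob D enc dec <= e%:E)%E.

Definition Cap (R : realType) (D : nat -> R) : \bar R :=
  ereal_sup [set r%:E | r in [set r : R | achievable D r]].

Definition geometric_pmf (R : realType) (p : R) (y : nat) : R :=
  (1 - p) * p ^+ y.

(* Main.v *)
Require Import Defs.
From mathcomp Require Import ring lra.

(** Let W(y|x) be the law of the output y of the channel on input x, and let Q
    be a finite measure on binary strings.  If sum_y W(y|x)^2 / Q(y) <= K^n for
    every input x of length n, then, by AM-GM applied to W / Q on the decoding
    regions, a code with M messages is decoded correctly with probability at
    most K^n / tau + tau Q(total) / M for every tau > 0; hence the rate of a
    reliable code is at most log K.

    Take for Q the Markov measure in which extending the current run costs a
    factor b = beta^2 and opening a new one costs h.  Given which bits are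
    deleted, each surviving bit appends a geometric number >= 1 of copies, and
    multiplies the chi-square sum by at most (1-p)^2/(beta-p)^2 inside a run,
    and by at most (1-p)^2 b / (h (b-p^2)) at the start of a run.  Deletions
    only mix these laws, so they are harmless by convexity of the square.  As p
    tends to 1, both factors can be made at most 8/5 < sqrt e, so that
    log_2 K <= 1/(2 log 2). *)

Set Implicit Arguments.
Unset Strict Implicit.
Unset Printing Implicit Defensive.

Local Open Scope classical_set_scope.
Local Open Scope ring_scope.

(** * Sums over the binary strings of length at most [L] *)

Fixpoint strings (L : nat) : seq (seq bool) :=
  if L is L'.+1 then
    [::] :: [seq c :: y | y <- strings L', c <- [:: false; true]]
  else [:: [::]].

Lemma sum_stringsS (V : nmodType) (L : nat) (F : seq bool -> V) :
  \sum_(y <- strings L.+1) F y =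
  F [::] + \sum_(y <- strings L) (F (false :: y) + F (true :: y)).
Proof.
rewrite big_cons big_allpairs_dep; congr (_ + _).
by apply: eq_bigr => y _; rewrite big_cons big_seq1.
Qed.

Lemma ler_sum_strings (R : numDomainType) (L L' : nat) (F : seq bool -> R) :
  (L <= L')%N -> (forall y, 0 <= F y) ->
  \sum_(y <- strings L) F y <= \sum_(y <- strings L') F y.
Proof.
elim: L L' F => [|L IH] [|L'] F //= LL F0.
  by rewrite big_seq1 sum_stringsS lerDl sumr_ge0 // => y _; rewrite addr_ge0.
by rewrite !sum_stringsS lerD2l IH // => y; rewrite addr_ge0.
Qed.

(** * The output law and its chi-square growth per input bit *)

Section Channel.
Variables (R : realFieldType) (p : R).
Implicit Types (v : seq bool -> R) (c : bool) (x y : seq bool).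

(* Strings are reversed: the latest output bit is the head.  If v is the law of
   the output so far, append_run v c is the law of the output after one more
   surviving bit c; the recursion expresses the lack of memory of the number of
   copies of c. *)
Fixpoint append_run v c y : R :=
  if y is c' :: y' then
    if c' == c then (1 - p) * v y' + p * append_run v c y' else 0
  else 0.

(** [1 - p] is the probability of zero copies; given survival, the number of copies is geometric
    from 1, which is the law that [append_run] appends. *)
Fixpoint output_law v x : seq bool -> R :=
  if x is c :: x' then
    output_law (fun y => (1 - p) * v y + p * append_run v c y) x'
  else v.

Lemma append_run_supp v c y : ohead y != Some c -> append_run v c y = 0.
Proof.
by case: y => [|c' y] //=; case: (eqVneq c' c) => [->|//]; rewrite eqxx.
Qed.

Lemma output_law_lin a b v w x y :
  output_law (fun z => a * v z + b * w z) x y =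
  a * output_law v x y + b * output_law w x y.
Proof.
elim: x v w => [|c x IH] v w //=; rewrite -IH; congr (output_law _ _ _).
apply/funext => z; suff -> : append_run (fun z => a * v z + b * w z) c z =
   a * append_run v c z + b * append_run w c z by ring.
elim: z => [|c' z IHz] /=; first by rewrite !mulr0 addr0.
by case: ifP => _; [rewrite IHz; ring | rewrite !mulr0 addr0].
Qed.

Variables b h : R.

Fixpoint ref_weight y : R :=
  if y is c :: y' then
    (if ohead y' == Some c then b else h) * ref_weight y'
  else 1.

(** The chi-square sum, cut off at length [L] so as to be a finite sum. *)
Definition energy (L : nat) v := \sum_(y <- strings L) v y ^+ 2 / ref_weight y.

Hypotheses (h_gt0 : 0 < h) (hb : h <= b) (bh_lt1 : b + h < 1).

Lemma b_gt0 : 0 < b. Proof. exact: lt_le_trans hb. Qed.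

Lemma ref_weight_gt0 y : 0 < ref_weight y.
Proof.
have b0 := b_gt0; elim: y => [|c y IH]; first exact: ltr01.
by rewrite mulr_gt0 //=; case: ifP.
Qed.

(** A nonempty string has one extension of factor [b] and one of factor [h], the empty string two of
    factor [h <= b]; hence a geometric series of ratio [b + h] dominates. *)
Lemma ref_weight_mass L : \sum_(y <- strings L) ref_weight y <= (1 - b - h)^-1.
Proof.
have [b0 h0 hb' bh] := And4 b_gt0 h_gt0 hb bh_lt1.
have D : 0 < 1 - b - h by lra.
rewrite -[leRHS]mul1r ler_pdivlMr //.
elim: L => [|L IH]; first by rewrite big_seq1 /=; lra.
rewrite sum_stringsS.
have : \sum_(y <- strings L) (ref_weight (false :: y) + ref_weight (true :: y))
    <= (b + h) * \sum_(y <- strings L) ref_weight y.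
  rewrite mulr_sumr; apply: ler_sum => y _ /=; rewrite -mulrDl.
  by apply: ler_wpM2r; [exact/ltW/ref_weight_gt0 | case: y => [|[] y] /=; lra].
have : 0 <= \sum_(y <- strings L) ref_weight y.
  by apply: sumr_ge0 => y _; exact/ltW/ref_weight_gt0.
rewrite [ref_weight [::]]/=; nra.
Qed.

Lemma energy_ge0 L v : 0 <= energy L v.
Proof.
by apply: sumr_ge0 => y _; rewrite divr_ge0 ?sqr_ge0 // ltW ?ref_weight_gt0.
Qed.

Lemma energy_convex L v w : 0 <= p <= 1 ->
  energy L (fun y => (1 - p) * v y + p * w y) <=
  (1 - p) * energy L v + p * energy L w.
Proof.
move=> /andP[p0 p1]; rewrite !mulr_sumr -big_split /=; apply: ler_sum => y _.
rewrite [(1 - p) * (_ / _)]mulrA [p * (_ / _)]mulrA -mulrDl ler_wpM2r //;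
  first by rewrite invr_ge0 ltW ?ref_weight_gt0.
rewrite -subr_ge0.
suff -> : (1 - p) * v y ^+ 2 + p * w y ^+ 2 - ((1 - p) * v y + p * w y) ^+ 2 =
    p * (1 - p) * (v y - w y) ^+ 2
  by rewrite mulr_ge0 ?sqr_ge0 // mulr_ge0 ?subr_ge0.
ring.
Qed.

(** Dropping the leading [c] turns the recursion of [append_run] into an inequality with the same
    finite energy on both sides; its uses have [B < 1] and solve for that energy. *)
Lemma append_run_energy L v c A B : 0 <= A -> 0 <= B ->
  (forall y, ((1 - p) * v y + p * append_run v c y) ^+ 2 /
     ref_weight (c :: y) <=
     A * (v y ^+ 2 / ref_weight y) +
     B * (append_run v c y ^+ 2 / ref_weight y)) ->
  energy L (append_run v c) <= A * energy L v + B * energy L (append_run v c).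
Proof.
move=> A0 B0 step.
have T0 w y : 0 <= w y ^+ 2 / ref_weight y.
  by rewrite divr_ge0 ?sqr_ge0 // ltW ?ref_weight_gt0.
case: L => [|L]; first by rewrite {1}/energy big_seq1 /= expr0n mul0r addr_ge0
  ?mulr_ge0 ?energy_ge0.
rewrite {1}/energy sum_stringsS [X in X + _](_ : _ = 0); last first.
  by rewrite /= expr0n mul0r.
rewrite add0r.
apply: (@le_trans _ _ (A * energy L v + B * energy L (append_run v c))).
  rewrite /energy !mulr_sumr -big_split /=; apply: ler_sum => y _.
  apply: le_trans (step y); rewrite /=.
  by case: (c) => /=; rewrite expr0n mul0r ?add0r ?addr0.
by rewrite lerD // ler_wpM2l // ler_sum_strings.
Qed.

(** The last output bit is known on the support of [v] ([None]: empty output), which decides whether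
    the next surviving bit extends a run. *)
Definition headed (l : option bool) v := forall y, ohead y != l -> v y = 0.

Variables (beta K : R).
Hypotheses (p_gt0 : 0 < p) (p_beta : p < beta) (beta_lt1 : beta < 1)
  (bE : b = beta ^+ 2).
Hypotheses (K_ge1 : 1 <= K)
  (K_same : (1 - p) ^+ 2 <= K * (beta - p) ^+ 2)
  (K_new : (1 - p) ^+ 2 * b <= K * (h * (b - p ^+ 2))).

(** Cauchy-Schwarz with weights [beta - p] and [p], of sum [beta], bounds [((1-p)s + pu)^2] by
    [beta ((1-p)^2 s^2 / (beta-p) + p u^2)]. Dividing by [b = beta ^+ 2] gives [A] and
    [p / beta]. *)
Lemma append_same_energy L v c : headed (Some c) v ->
  energy L (append_run v c) <= K * energy L v.
Proof.
have [p0 pb b1] := And3 p_gt0 p_beta beta_lt1.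
move=> hv; have beta_gt0 : 0 < beta by lra.
have d0 : 0 < beta - p by lra.
pose A := (1 - p) ^+ 2 / (beta * (beta - p)).
have A0 : 0 <= A by rewrite divr_ge0 ?sqr_ge0 // mulr_ge0 // ltW.
have B0 : 0 <= p / beta by rewrite divr_ge0 ?ltW.
have step y : ((1 - p) * v y + p * append_run v c y) ^+ 2 /
     ref_weight (c :: y) <= A * (v y ^+ 2 / ref_weight y) +
     p / beta * (append_run v c y ^+ 2 / ref_weight y).
  rewrite /=; case: ifP => [_|/negbT hd]; last first.
    by rewrite hv // append_run_supp // !mulr0 addr0 expr0n !mul0r !mulr0 addr0.
  have q0 := ref_weight_gt0 y; move: (ref_weight y) q0 (v y) (append_run v c y).
  move=> q q0 s u.
  rewrite [A * _]mulrA [p / beta * _]mulrA -mulrDl invfM mulrA.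
  rewrite ler_wpM2r ?invr_ge0 ?(ltW q0) //.
  rewrite ler_pdivrMr ?bE ?exprn_gt0 // /A -subr_ge0.
  have -> : ((1 - p) ^+ 2 / (beta * (beta - p)) * s ^+ 2 + p / beta * u ^+ 2) *
     beta ^+ 2 - ((1 - p) * s + p * u) ^+ 2 =
     (p / (beta - p)) * ((1 - p) * s - (beta - p) * u) ^+ 2.
    by field; rewrite !gt_eqF.
  by rewrite mulr_ge0 ?sqr_ge0 // divr_ge0 // ltW.
have := append_run_energy L A0 B0 step.
set X := energy L _; set Y := energy L v => E.
have Y0 : 0 <= Y := energy_ge0 L v.
have E2 : X * (beta - p) ^+ 2 <= (1 - p) ^+ 2 * Y.
  have -> : (1 - p) ^+ 2 * Y = (A * Y) * (beta * (beta - p)).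
    by rewrite /A; field; rewrite !gt_eqF.
  have -> : X * (beta - p) ^+ 2 = (X - p / beta * X) * (beta * (beta - p)).
    by field; rewrite gt_eqF.
  by apply: ler_wpM2r; [rewrite mulr_ge0 // ltW | lra].
have d2 : 0 < (beta - p) ^+ 2 by rewrite exprn_gt0.
rewrite -(ler_pM2r d2) (le_trans E2) // [leRHS]mulrAC.
by rewrite ler_wpM2r.
Qed.

(** Here [v] and [append_run v c] have disjoint supports, so the square has no cross term: the part
    from [v] pays [h], the part from the growing run pays [b]. *)
Lemma append_new_energy L v c l : headed l v -> l != Some c ->
  energy L (append_run v c) <= K * energy L v.
Proof.
have [b0 h0 p0 pb] := And4 b_gt0 h_gt0 p_gt0 p_beta.
move=> hv lc.
have bp : 0 < b - p ^+ 2 by rewrite bE; nra.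
have A0 : 0 <= (1 - p) ^+ 2 / h by rewrite divr_ge0 ?sqr_ge0 // ltW.
have B0 : 0 <= p ^+ 2 / b by rewrite divr_ge0 ?sqr_ge0 // ltW.
have step y : ((1 - p) * v y + p * append_run v c y) ^+ 2 /
     ref_weight (c :: y) <= (1 - p) ^+ 2 / h * (v y ^+ 2 / ref_weight y) +
     p ^+ 2 / b * (append_run v c y ^+ 2 / ref_weight y).
  rewrite /=; case: ifP => [/eqP hd|/negbT hd].
    rewrite hv ?hd 1?eq_sym // mulr0 add0r expr0n mul0r mulr0 add0r.
    by rewrite exprMn mulf_div.
  rewrite append_run_supp // mulr0 addr0 expr0n mul0r mulr0 addr0.
  by rewrite exprMn mulf_div.
have := append_run_energy L A0 B0 step.
set X := energy L _; set Y := energy L v => E.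
have Y0 : 0 <= Y := energy_ge0 L v.
have E2 : X * (h * (b - p ^+ 2)) <= (1 - p) ^+ 2 * b * Y.
  have -> : (1 - p) ^+ 2 * b * Y = ((1 - p) ^+ 2 / h * Y) * (h * b).
    by field; rewrite gt_eqF.
  have -> : X * (h * (b - p ^+ 2)) = (X - p ^+ 2 / b * X) * (h * b).
    by field; rewrite gt_eqF.
  by apply: ler_wpM2r; [rewrite mulr_ge0 // ltW | lra].
have d2 : 0 < h * (b - p ^+ 2) by rewrite mulr_gt0.
rewrite -(ler_pM2r d2) (le_trans E2) // [leRHS]mulrAC.
by rewrite ler_wpM2r.
Qed.

(** Deletion keeps the head [l], survival makes it [Some c], so both branches stay within the
    induction hypothesis; [K_ge1] covers the deletion branch, which gains no factor. *)
Lemma output_law_energy L l v x : headed l v ->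
  energy L (output_law v x) <= K ^+ size x * energy L v.
Proof.
have [p0 pb b1 K1] := And4 p_gt0 p_beta beta_lt1 K_ge1.
have p1 : 0 <= p <= 1 by apply/andP; split; lra.
elim: x l v => [|c x IH] l v hv /=; first by rewrite expr0 mul1r.
have -> : output_law (fun y => (1 - p) * v y + p * append_run v c y) x =
    fun y => (1 - p) * output_law v x y + p * output_law (append_run v c) x y.
  by apply/funext => y; rewrite output_law_lin.
have Er : energy L (append_run v c) <= K * energy L v.
  case: (eqVneq l (Some c)) hv => [->|lc] hv; first exact: append_same_energy.
  exact: append_new_energy hv lc.
have Ks0 : 0 <= K ^+ size x by rewrite exprn_ge0 //; lra.
have Ev := IH l v hv.
have Eu : energy L (output_law (append_run v c) x) <=
    K ^+ size x * (K * energy L v).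
  apply: le_trans (IH (Some c) _ (@append_run_supp v c)) _.
  by rewrite ler_wpM2l.
apply: le_trans (energy_convex _ _ _ p1) _.
have Ev' : energy L (output_law v x) <= K ^+ size x * (K * energy L v).
  apply: le_trans Ev _; rewrite ler_wpM2l //.
  by have := energy_ge0 L v; nra.
rewrite exprSr -mulrA.
by case/andP: p1 => p0' p1'; nra.
Qed.

End Channel.

(** * Averages over replication patterns with all entries below [N] *)

Fixpoint pattern_avg (R : realFieldType) (D : nat -> R) (N : nat)
    (phi : seq bool -> R) (x y : seq bool) : R :=
  if x is c :: x' then
    \sum_(j < N) D j * pattern_avg D N phi x' (nseq j c ++ y)
  else phi y.

Lemma pattern_avg_cst (R : realFieldType) (D : nat -> R) N x y :
  pattern_avg D N (fun=> 1) x y = (\sum_(j < N) D j) ^+ size x.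
Proof.
elim: x y => [|c x IH] y //=.
by under eq_bigr do rewrite IH; rewrite -mulr_suml exprS.
Qed.

Lemma pattern_avgB (R : realFieldType) (D : nat -> R) N f g x y :
  pattern_avg D N (fun z => f z - g z) x y =
  pattern_avg D N f x y - pattern_avg D N g x y.
Proof.
elim: x y => [|c x IH] y //=; rewrite -sumrB.
by apply: eq_bigr => j _; rewrite IH mulrBr.
Qed.

Lemma pattern_avg_ge0 (R : realFieldType) (D : nat -> R) N f x y :
  (forall j, 0 <= D j) -> (forall z, 0 <= f z) -> 0 <= pattern_avg D N f x y.
Proof.
move=> D0 f0; elim: x y => [|c x IH] y //=.
by apply: sumr_ge0 => j _; rewrite mulr_ge0.
Qed.

Lemma geometric_pmf_sum (R : realType) (p : R) N :
  \sum_(j < N) geometric_pmf p j = 1 - p ^+ N.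
Proof.
rewrite /geometric_pmf -mulr_sumr -[in RHS](expr1n R N) subrXX.
by congr (_ * _); apply: eq_bigr => i _; rewrite expr1n mul1r.
Qed.

Lemma append_run_ge0 (R : realFieldType) (p : R) v c y :
  0 <= p <= 1 -> (forall z, 0 <= v z) -> 0 <= append_run p v c y.
Proof.
move=> /andP[p0 p1] v0; elim: y => //= c' y IH.
by case: ifP => // _; rewrite addr_ge0 // mulr_ge0 // subr_ge0.
Qed.

(** The term [j = 0] is the deletion; the others are [p] times the same sum for [phi (c :: _)],
    matching the recursion of [append_run]. *)
Lemma pattern_avg_step (R : realType) (p : R) v c phi L N :
  0 <= p <= 1 -> (forall z, 0 <= v z) -> (forall z, 0 <= phi z) ->
  \sum_(j < N) geometric_pmf p j *
    (\sum_(y <- strings L) v y * phi (nseq j c ++ y))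
  <= \sum_(y <- strings (L + N))
       ((1 - p) * v y + p * append_run p v c y) * phi y.
Proof.
move=> p01 v0; have /andP[p0 p1] := p01.
have r0 z := append_run_ge0 c z p01 v0.
elim: N phi => [|N IH] phi phi0.
  rewrite big_ord0; apply: sumr_ge0 => y _.
  by rewrite mulr_ge0 // addr_ge0 // mulr_ge0 // subr_ge0.
under [leRHS]eq_bigr do rewrite mulrDl -!mulrA.
rewrite big_split /= -!mulr_sumr big_ord_recl /geometric_pmf expr0 mulr1.
apply: lerD.
  rewrite ler_wpM2l ?subr_ge0 //.
  by apply: ler_sum_strings; rewrite ?leq_addr // => y; rewrite mulr_ge0.
have -> : \sum_(y <- strings (L + N.+1)) append_run p v c y * phi y =
    \sum_(y <- strings (L + N))
      ((1 - p) * v y + p * append_run p v c y) * phi (c :: y).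
  rewrite addnS sum_stringsS mul0r add0r; apply: eq_bigr => y _ /=.
  by case: c {r0 IH} => /=; rewrite !mul0r ?add0r ?addr0.
apply: le_trans (ler_wpM2l p0 (IH (fun y => phi (c :: y)) _)) => //.
rewrite mulr_sumr; apply: ler_sum => j _.
by rewrite /geometric_pmf /= /bump /= exprS !mulrA [p * _]mulrC.
Qed.

Lemma pattern_avg_le (R : realType) (p : R) v phi x L N :
  0 <= p <= 1 -> (forall z, 0 <= v z) -> (forall z, 0 <= phi z) ->
  \sum_(y <- strings L) v y * pattern_avg (geometric_pmf p) N phi x y
  <= \sum_(y <- strings (L + N * size x)) output_law p v x y * phi y.
Proof.
move=> p01 v0 phi0; have /andP[p0 p1] := p01.
have D0 j : 0 <= geometric_pmf p j by rewrite mulr_ge0 ?subr_ge0 ?exprn_ge0.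
elim: x v L v0 => [|c x IH] v L v0 /=; first by rewrite muln0 addn0.
rewrite mulnS addnA.
apply: le_trans (IH _ _ _); last first.
  by move=> z; rewrite addr_ge0 // mulr_ge0 ?subr_ge0 ?append_run_ge0.
apply: le_trans (pattern_avg_step c L N p01 v0 _); last first.
  by move=> z; exact: pattern_avg_ge0.
under eq_bigr do rewrite mulr_sumr.
rewrite exchange_big /= ler_sum // => j _.
by rewrite mulr_sumr ler_sum // => y _; rewrite mulrCA.
Qed.

Lemma sum_tupleS (V : nmodType) (T : finType) n (F : n.+1.-tuple T -> V) :
  \sum_(d : n.+1.-tuple T) F d =
  \sum_(j : T) \sum_(d : n.-tuple T) F [tuple of j :: d].
Proof.
rewrite pair_big /=.
rewrite (reindex (fun q : T * n.-tuple T => [tuple of q.1 :: q.2])) //=.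
exists (fun d => (thead d, [tuple of behead d])) => [[j d] _|d _] /=.
  by congr (_, _); apply: val_inj.
by rewrite -tuple_eta.
Qed.

Lemma repeat_output_cons n (c : bool) (x : n.-tuple bool) (j : nat)
    (d : n.-tuple nat) :
  repeat_output [tuple of c :: x] [tuple of j :: d] =
  nseq j c ++ repeat_output x d.
Proof.
rewrite /repeat_output enum_ordSl /= !tnth0 -map_comp; congr (_ ++ flatten _).
by apply: eq_map => i /=; rewrite !tnthS.
Qed.

Definition natpat n N (d : n.-tuple 'I_N) : n.-tuple nat :=
  [tuple of map val d].

Lemma sum_patterns (R : realFieldType) (D : nat -> R) N (phi : seq bool -> R) n
    (x : n.-tuple bool) (y : seq bool) :
  \sum_(d : n.-tuple 'I_N) (\prod_(i < n) D (tnth d i)) *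
     phi (rev (repeat_output x (natpat d)) ++ y) =
  pattern_avg D N phi x y.
Proof.
elim: n x y => [|n IH] x y.
  rewrite (tuple0 x) (big_pred1 [tuple]) => [|d];
    last by apply/esym/eqP; exact: tuple0.
  by rewrite big_ord0 mul1r /repeat_output enum_ord0.
case/tupleP: x => c x; rewrite sum_tupleS /=; apply: eq_bigr => j _.
rewrite -IH mulr_sumr; apply: eq_bigr => d _.
rewrite big_ord_recl tnth0 -mulrA; congr (_ * (_ * phi _)).
  by apply: eq_bigr => i _; rewrite tnthS.
rewrite (_ : natpat _ = [tuple of (j : nat) :: natpat d]); last exact: val_inj.
by rewrite repeat_output_cons rev_cat rev_nseq catA.
Qed.

(** A sum of nonnegative terms dominates its restriction to the finitely many patterns with entries
    below [N]; [rev] undoes the reversed storage. *)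
Lemma repeat_law_ge (R : realType) (D : nat -> R) n (x : n.-tuple bool)
    (B : pred (seq bool)) N : (forall j, 0 <= D j) ->
  ((pattern_avg D N (fun y => (B (rev y))%:R) x [::])%:E <=
   repeat_law D x [set y | B y])%E.
Proof.
move=> D0; apply: esum_ge.
pose s := [seq natpat d | d <- index_enum {: n.-tuple 'I_N} &
  B (repeat_output x (natpat d))].
have us : uniq s.
  rewrite map_inj_uniq ?filter_uniq ?index_enum_uniq // => d e /(congr1 val) /=.
  by move=> /(inj_map val_inj) /val_inj.
exists [set` s].
  split; first exact: finite_seq.
  by move=> d /= /mapP[e]; rewrite mem_filter => /andP[Be _] ->.
rewrite -fsbig_seq // /s big_map big_filter /= sumEFin lee_fin.
rewrite -sum_patterns [leRHS]big_mkcond /= ler_sum // => d _.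
rewrite cats0 revK; under [in leRHS]eq_bigr do rewrite tnth_map.
by case: ifP => _; rewrite ?mulr1 ?mulr0.
Qed.

(** * Converse bound on achievable rates *)

Definition admissible (R : realFieldType) (p beta h K : R) : Prop :=
  [/\ [/\ 0 < p, p < beta & beta < 1],
      [/\ 0 < h, h <= beta ^+ 2 & beta ^+ 2 + h < 1],
      1 <= K,
      (1 - p) ^+ 2 <= K * (beta - p) ^+ 2 &
      (1 - p) ^+ 2 * beta ^+ 2 <= K * (h * (beta ^+ 2 - p ^+ 2))].

Lemma success_sum_le (R : realType) (p beta h K tau : R) (n M N : nat)
    (enc : 'I_M -> n.-tuple bool) (dec : seq bool -> 'I_M) :
  admissible p beta h K -> 0 < tau ->
  \sum_(m < M) pattern_avg (geometric_pmf p) N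
      (fun y => (dec (rev y) == m)%:R) (enc m) [::] <=
  M%:R * (K ^+ n / tau) + tau / (1 - beta ^+ 2 - h).
Proof.
move=> [[p0 pb b1] [h0 hb bh] K1 same new] t0.
have p01 : 0 <= p <= 1 by apply/andP; split; lra.
pose v (y : seq bool) : R := (y == [::])%:R.
have hv : headed None v by move=> [|c y].
have v0 z : 0 <= v z by rewrite /v ler0n.
pose Q := ref_weight (beta ^+ 2) h.
have Q0 y : 0 < Q y by exact: ref_weight_gt0.
pose L := (N * n)%N.
have bound m : pattern_avg (geometric_pmf p) N
      (fun y => (dec (rev y) == m)%:R) (enc m) [::] <=
    K ^+ n / tau + tau * \sum_(y <- strings L) Q y * (dec (rev y) == m)%:R.
  have := @pattern_avg_le R p v (fun y => (dec (rev y) == m)%:R)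
    (enc m) 0 N p01 v0 (fun _ => ler0n _ _).
  rewrite big_seq1 mul1r add0n size_tuple => /le_trans; apply.
  have E1 : energy (beta ^+ 2) h L (output_law p v (enc m)) <= K ^+ n.
    have := @output_law_energy R p _ _ h0 hb _ K p0 pb b1 erefl K1 same new L
      None v (enc m) hv.
    rewrite size_tuple => /le_trans; apply; rewrite -[leRHS]mulr1 ler_wpM2l //.
      by rewrite exprn_ge0 //; lra.
    have -> : energy (beta ^+ 2) h L v = energy (beta ^+ 2) h 0 v.
      rewrite /energy big_seq1; case: (L) => [|L']; first by rewrite big_seq1.
      rewrite sum_stringsS big1 ?addr0 // => y _.
      by rewrite /v /= expr0n !mul0r addr0.
    by rewrite /energy big_seq1 /v eqxx expr1n divr1.
  apply: (@le_trans _ _ (energy (beta ^+ 2) h L (output_law p v (enc m)) / tau +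
    tau * \sum_(y <- strings L) Q y * (dec (rev y) == m)%:R)); last first.
    by rewrite lerD2r ler_pM2r ?invr_gt0.
  rewrite /energy mulr_suml mulr_sumr -big_split /=; apply: ler_sum => y _.
  rewrite -/Q; have := Q0 y; move: (Q y) (output_law p v (enc m) y) => q w q0.
  have A0 : 0 <= w ^+ 2 / q / tau by rewrite !divr_ge0 ?sqr_ge0 // ltW.
  case: eqP => _; rewrite ?mulr0 ?addr0 // !mulr1.
  have AMGM : 2 * w <= w ^+ 2 / q / tau + tau * q.
    rewrite -subr_ge0.
    have -> : w ^+ 2 / q / tau + tau * q - 2 * w = (w - tau * q) ^+ 2 / q / tau.
      by field; rewrite !gt_eqF.
    by rewrite !divr_ge0 ?sqr_ge0 // ltW.
  have : 0 < tau * q by rewrite mulr_gt0.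
  lra.
apply: le_trans (ler_sum _ (fun m _ => bound m)) _.
rewrite big_split /= sumr_const card_ord -[_ *+ M]mulr_natl lerD2l -mulr_sumr.
(* The decoding regions partition the strings, so each [Q y] is counted once. *)
rewrite ler_wpM2l ?(ltW t0) // exchange_big /=.
apply: le_trans (ref_weight_mass h0 hb bh L); apply: ler_sum => y _.
rewrite -mulr_sumr (bigD1 (dec (rev y))) //= eqxx big1 ?addr0 ?mulr1 // => m.
by rewrite eq_sym => /negbTE ->.
Qed.

(** Patterns with entries below [N] have total mass [(1 - p ^+ N) ^+ n]; on them, error is the
    complement of success. *)
Lemma error_prob_ge (R : realType) (p beta h K tau : R) (n M N : nat)
    (enc : 'I_M -> n.-tuple bool) (dec : seq bool -> 'I_M) :
  admissible p beta h K -> 0 < tau -> (0 < M)%N ->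
  (((1 - p ^+ N) ^+ n - K ^+ n / tau - tau / (1 - beta ^+ 2 - h) / M%:R)%:E <=
   error_prob (geometric_pmf p) enc dec)%E.
Proof.
move=> adm t0 M0; have [[p0 pb b1] _ _ _ _] := adm.
have D0 j : 0 <= geometric_pmf p j.
  by rewrite mulr_ge0 ?exprn_ge0 ?subr_ge0; lra.
have M0' : 0 < M%:R :> R by rewrite ltr0n.
pose S m := pattern_avg (geometric_pmf p) N
      (fun y => (dec (rev y) == m)%:R) (enc m) [::].
have law m : (((1 - p ^+ N) ^+ n - S m)%:E <=
    repeat_law (geometric_pmf p) (enc m) [set y : seq bool | dec y != m])%E.
  apply: le_trans (repeat_law_ge (enc m) (fun y => dec y != m) N D0).
  rewrite lee_fin /S -geometric_pmf_sum -{1}(size_tuple (enc m)).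
  rewrite -(pattern_avg_cst _ _ _ [::]) -pattern_avgB.
  rewrite le_eqVlt; apply/orP; left; apply/eqP; congr (pattern_avg _ _ _ _ _).
  by apply/funext => y; case: eqP => _; rewrite ?subrr ?subr0.
rewrite /error_prob.
apply: (@le_trans _ _ ((M%:R^-1)%:E *
    \sum_(m < M) ((1 - p ^+ N) ^+ n - S m)%:E)%E); last first.
  by rewrite lee_wpmul2l ?lee_fin ?invr_ge0 ?ler0n // lee_sum.
rewrite sumEFin -EFinM lee_fin sumrB sumr_const card_ord.
rewrite -[(1 - p ^+ N) ^+ n *+ M]mulr_natl.
have := success_sum_le N enc dec adm t0; rewrite -/(S _).
set T := (\sum_(m < M) _) => TS.
rewrite mulrBr mulKf ?gt_eqF // -addrA lerD2l -opprD lerN2 mulrC.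
rewrite ler_pdivrMr // mulrDl divfK ?gt_eqF //.
by rewrite [_ / tau * _]mulrC.
Qed.

(** If [K < s = 2^r], then [tau = 4 K^n] and [M >= s^n] bound the success terms by [1/4 + 1/8] for
    large [n]. Choosing [N] after [n] makes the truncation loss less than [1/8], so the error
    exceeds [1/2], against [1/4]. *)
Lemma achievable_le (R : realType) (p beta h K r : R) :
  admissible p beta h K -> achievable (geometric_pmf p) r -> r <= ln K / ln 2.
Proof.
move=> adm ach; have [[p0 pb b1] [h0 hb bh] K1 _ _] := adm.
have K0 : 0 < K by lra.
have ln2 : 0 < ln 2 :> R by rewrite ln_gt0 // ltr1n.
rewrite ler_pdivlMr // leNgt; apply/negP => Kr.
pose s : R := 2 `^ r.
have Ks : K < s.
  by rewrite -ltr_ln ?posrE ?powR_gt0 // ln_powR.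
have s0 : 0 < s by lra.
pose C := 4 / (1 - beta ^+ 2 - h).
have small : \forall n \near \oo, C * (K / s) ^+ n < 8^-1.
  have z1 : `|K / s| < 1
    by rewrite ger0_norm ?divr_ge0 ?ltW // ltr_pdivrMr ?mul1r.
  have := cvg_geometric C z1 => /cvgr_lt; apply; lra.
have q4 : (0 : R) < 4^-1 by lra.
have [n [[M [enc [dec [rM err]]]] sn]] := filter_ex (filterI (ach _ q4) small).
have M0 : 0 < M%:R :> R by apply: lt_le_trans rM; rewrite powR_gt0.
rewrite ltr0n in M0 *.
have [N pN] : exists N : nat, n%:R * p ^+ N < 8^-1.
  have z1 : `|p| < 1 by rewrite ger0_norm; lra.
  have := cvg_geometric (n%:R : R) z1 => /cvgr_lt /(_ 8^-1).
  by case/(_ _)/filter_ex; [lra | move=> N; exists N].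
have t0 : 0 < 4 * K ^+ n by rewrite mulr_gt0 ?exprn_gt0.
have := le_trans (error_prob_ge N enc dec adm t0 M0) err; rewrite lee_fin.
have -> : K ^+ n / (4 * K ^+ n) = 4^-1 by field; rewrite gt_eqF ?exprn_gt0.
have Mle : 4 * K ^+ n / (1 - beta ^+ 2 - h) / M%:R <= C * (K / s) ^+ n.
  have -> : C * (K / s) ^+ n = 4 * K ^+ n / (1 - beta ^+ 2 - h) / s ^+ n.
    by rewrite /C expr_div_n; field; rewrite !gt_eqF ?exprn_gt0 //; lra.
  rewrite ler_wpM2l ?divr_ge0 ?(ltW t0) //; first by lra.
  rewrite lef_pV2 ?posrE ?ltr0n ?exprn_gt0 // (le_trans _ rM) //.
  by rewrite /s mulrC powRrM powR_mulrn ?powR_ge0.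
have Bern : 1 - n%:R * p ^+ N <= (1 - p ^+ N) ^+ n.
  have [q0 q1] : 0 <= p ^+ N /\ p ^+ N <= 1.
    by split; [rewrite exprn_ge0 // ltW | rewrite exprn_ile1 //; lra].
  elim: (n) => [|k IH]; first by rewrite mul0r subr0.
  rewrite exprS -natr1; have : 0 <= k%:R :> R by rewrite ler0n.
  nra.
lra.
Qed.

(** * Numerical bounds, choice of parameters, and conclusion *)

Lemma expR_ge_series (R : realType) (x : R) n :
  0 <= x -> \sum_(k < n) x ^+ k / k`!%:R <= expR x.
Proof.
move=> x0; rewrite -(big_mkord xpredT (fun k => x ^+ k / k`!%:R)).
apply: (@nondecreasing_cvgn_le _ (series (exp_coeff x))); last first.
  exact: is_cvg_series_exp_coeff.
apply/nondecreasing_seqP => k; rewrite /series /= big_nat_recr //= lerDl.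
by rewrite /exp_coeff /= divr_ge0 ?exprn_ge0.
Qed.

Lemma expR_le_series (R : realType) (x : R) n : 0 <= x <= 1 -> (0 < n)%N ->
  expR x <= \sum_(k < n) x ^+ k / k`!%:R + 2 * (x ^+ n / n`!%:R).
Proof.
move=> /andP[x0 x1] n0; pose t k : R := x ^+ k / k`!%:R.
have t0 k : 0 <= t k by rewrite divr_ge0 ?exprn_ge0.
(* the series is dominated from rank n on by a geometric series of ratio 1/2 *)
have half k : (0 < k)%N -> 2 * t k.+1 <= t k.
  move=> k0; have -> : t k.+1 = t k * (x / k.+1%:R).
    by rewrite /t factS mulnC natrM exprSr mulf_div.
  rewrite mulrCA -[leRHS]mulr1 ler_wpM2l // mulrA ler_pdivrMr ?ltr0n // mul1r.
  by have : 2 <= k.+1%:R :> R; [rewrite ler_nat | lra].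
have step m : \sum_(k < n + m) t k + 2 * t (n + m)%N <=
    \sum_(k < n) t k + 2 * t n.
  elim: m => [|m IH]; first by rewrite addn0.
  rewrite addnS big_ord_recr /=; apply: le_trans IH.
  have : 2 * t (n + m).+1 <= t (n + m)%N by rewrite half // addn_gt0 n0.
  lra.
apply: limr_le; first exact: is_cvg_series_exp_coeff.
exists n => // k /= nk; rewrite /series /= big_mkord -(subnKC nk).
apply: (le_trans _ (step (k - n)%N)).
by rewrite lerDl mulr_ge0.
Qed.

(** These fractions place [1 / (2 ln 2)] between 88/122 and 101/140, inside [0.7213, 0.7215]. *)
Lemma ln2_bounds (R : realType) : 70 / 101 < ln (2 : R) < 61 / 88.
Proof.
have pos2 : (2 : R) \is Num.pos by rewrite posrE.
apply/andP; split; rewrite -ltr_expR lnK.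
- apply: le_lt_trans (@expR_le_series _ _ 8 _ isT) _; first lra.
  by rewrite !big_ord_recr big_ord0 /= !factS fact0 !natrM; lra.
- by [].
- apply: lt_le_trans (@expR_ge_series _ _ 8 _); last lra.
  by rewrite !big_ord_recr big_ord0 /= !factS fact0 !natrM; lra.
- by [].
Qed.

(** Three Taylor terms give [exp(1/2) >= 13/8 > 8/5]. *)
Lemma ln_8_5 (R : realType) : ln (8 / 5 : R) <= 1 / 2.
Proof.
rewrite -ler_expR lnK ?posrE; last lra.
apply: le_trans (@expR_ge_series _ _ 3 _); last lra.
by rewrite !big_ord_recr big_ord0 /= !factS fact0 !natrM; lra.
Qed.

(* With 1 - beta = t (1 - p), the two factors tend to 1/(1-t)^2 and, for
   h = 2 t' (1-p), to 1/(4 t' (1-t)) as p tends to 1; here t = 1/5, and t' =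
   0.198 is slightly less than t, as b + h < 1 requires. *)
Lemma admissible_near1 (R : realType) (p : R) : 49 / 50 <= p < 1 ->
  admissible p (1 - (1 - p) / 5) (396 / 1000 * (1 - p)) (8 / 5).
Proof.
move=> /andP[p0 p1].
have [d [-> d0 d1]] : exists d, [/\ p = 1 - d, 0 < d & d <= 1 / 50].
  by exists (1 - p); split; lra.
by split; [split; lra | split; nra | lra | nra | nra].
Qed.

(** Serves only to give a finite bound for [p] away from 1. As [1 - p = 2 (beta - p)], the summand 4
    of [K] settles the same-run condition, and [c] the new-run one. *)
Lemma admissible_exists (R : realType) (p : R) : 0 < p < 1 ->
  exists beta h K, admissible p beta h K.
Proof.
move=> /andP[p0 p1]; pose beta := (1 + p) / 2; pose h := (1 - beta ^+ 2) / 4.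
have [b0 b1 pb] : [/\ 1 / 2 < beta, beta < 1 & p < beta].
  by split; rewrite /beta; lra.
have h0 : 0 < h by rewrite /h; nra.
have d0 : 0 < h * (beta ^+ 2 - p ^+ 2) by rewrite mulr_gt0 //; nra.
have c0 : 0 <= (1 - p) ^+ 2 * beta ^+ 2 / (h * (beta ^+ 2 - p ^+ 2)).
  by rewrite divr_ge0 ?(ltW d0) // mulr_ge0 // sqr_ge0.
set c := _ / _ in c0; exists beta, h, (4 + c).
split; first by split.
- by split => //; rewrite /h; nra.
- lra.
- have -> : 1 - p = 2 * (beta - p) by rewrite /beta; lra.
  by have : 0 <= (beta - p) ^+ 2 by [exact: sqr_ge0]; nra.
- by rewrite mulrDl /c divfK ?gt_eqF // lerDr mulr_ge0 // ltW.
Qed.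

Theorem theorem18 (R : realType) :
  (exists o : R -> R,
     o p @[p --> 1^'-] --> (0 : R) /\
     forall p : R, 0 < p < 1 ->
       (Cap (geometric_pmf p) <= (1 / (2 * ln 2) + o p)%:E)%E) /\
  `|1 / (2 * ln (2 : R)) - 7214 / 10 ^+ 4| <= 1 / 10 ^+ 4.
Proof.
have /andP[l1 l2] := ln2_bounds R.
have ln2 : 0 < ln 2 :> R by lra.
split; last first.
  rewrite ler_distl; apply/andP; split.
    by rewrite ler_pdivlMr; lra.
  by rewrite ler_pdivrMr; lra.
have bound (p : R) : exists B : R, 0 < p < 1 ->
    forall r, achievable (geometric_pmf p) r -> r <= B.
  have [p01|] := boolP (0 < p < 1); last by exists 0.
  have [beta [h [K adm]]] := admissible_exists p01.
  by exists (ln K / ln 2) => _ r; exact: achievable_le adm.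
have [B BP] := choice bound.
(* From 49/50 on, the bound [1 / (2 ln 2)] holds without error; below, [o] makes up the difference
   to the finite bound [B p]. *)
exists (fun p => if p < 49 / 50 then B p - 1 / (2 * ln 2) else 0); split.
  apply: cvg_near_cst; near=> p; rewrite ltNge ifF //; apply/negbF/ltW.
  by near: p; apply: nbhs_left_gt; lra.
move=> p p01; have /andP[p0 p1] := p01.
apply: ge_ereal_sup => _ /= [r ach <-]; rewrite lee_fin.
case: ltP => [_|p49]; first by rewrite addrC subrK; exact: BP ach.
have adm : admissible p (1 - (1 - p) / 5) (396 / 1000 * (1 - p)) (8 / 5).
  by apply: admissible_near1; rewrite p49.
apply: le_trans (achievable_le adm ach) _.
rewrite addr0 invfM mulrA ler_pM2r ?invr_gt0 //.
exact: ln_8_5.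
Unshelve. all: by end_near. Qed.
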